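(* Let $G^{\rm r}$ be the ring graph on $n\ge 3$ nodes, influenced by a fixed intelligent adversary with capability $k$, $1\le k\leq n$. Then $$\alpha^{\rm sus}\left(G^{\rm r},\mathrm{FI}(k)\right) = \frac{k}{n}.$$ This can be realized by an adversary distributing its influence set as evenly as possible around the ring: there exist sets $S\subseteq N$ with $|S|=k$ satisfying $$\left|S\cap [i,i+t-1]\right| \leq \left\lceil \frac{kt}{n}\right\rceil\qquad\text{for all } i\in N,\ 1\le t\leq n,$$ and for every such $S$ and every $\alpha<k/n$, $\vec{y}$ is strictly stochastically stable in the game $(G^{\rm r},\alpha)$ when the adversary influences $S$.
   Context: Ring graph: $N=\{1,\dots,n\}$, edges $\{i,i+1\}$ with indices mod $n$. For nodes, $[i,j]:=\{i,i+1,\dots,j\}\subseteq N$ with indices mod $n$, so $[i,i+t-1]$ consists of $t$ consecutive nodes. Graphical coordination game $(G,\alpha)$, $\alpha\in\mathbb{R}$: agents $N$ each choose an action in $\{x,y\}$; joint action space $\mathcal{A}=\{x,y\}^n$. The two-player payoff is $u(x,x)=1+\alpha$, $u(y,y)=1$, $u(x,y)=u(y,x)=0$. With $\mathcal{N}_i=\{j:\{i,j\}\in E\}$, $U_i(a)=\sum_{j\in\mathcal{N}_i}u(a_i,a_j)$. Write $\vec{x}=(x,\dots,x)$, $\vec{y}=(y,\dots,y)$. Adversarial influence: for an influence set $S\subseteq N$, the influenced utility is $\tilde U_i(a,S)=U_i(a)+1$ if $i\in S$ and $a_i=y$, and $\tilde U_i(a,S)=U_i(a)$ otherwise. A fixed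 intelligent adversary with capability $k$ (type $\mathrm{FI}(k)$) commits to one set $S$ with $|S|=k$ for all time (it may depend on $G$ and $\alpha$). Log-linear learning with parameter $\beta>0$: at each time $t=0,1,2,\dots$ an agent $i$ is selected uniformly at random from $N$; all other agents keep their actions, and agent $i$ chooses its next action to be $x$ with probability $$\frac{e^{\beta \tilde U_i((x,a_{-i}),S)}}{e^{\beta \tilde U_i((x,a_{-i}),S)}+e^{\beta \tilde U_i((y,a_{-i}),S)}}$$ and $y$ otherwise, where $a=a(t)$ is the current joint action. This is an irreducible aperiodic Markov chain on $\mathcal{A}$ with unique stationary distribution $\pi_\beta$; let $\pi=\lim_{\beta\to\infty}\pi_\beta$. A joint action $a$ is strictly stochastically stable if $\pi(a)=1$. Susceptibility: $(G,\alpha)$ is susceptible to $\mathrm{FI}(k)$ if there is $S\subseteq N$ with $|S|=k$ for which $\vec{y}$ is strictly stochastically stable; $\alpha^{\rm sus}(G,\mathrm{FI}(k))=\sup\{\alpha\in\mathbb{R}: (G,\alpha)\text{ is susceptible to }\mathrm{FI}(k)\}$. *)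

(* Defs.v *)
From HB Require Import structures.
From mathcomp Require Import all_boot all_order all_algebra.
From mathcomp Require Import all_classical all_reals all_analysis.

Set Implicit Arguments.
Unset Strict Implicit.
Unset Printing Implicit Defensive.

Import Order.TTheory GRing.Theory Num.Theory.
Import numFieldNormedType.Exports.

Local Open Scope classical_set_scope.
Local Open Scope ring_scope.

Inductive action := ActX | ActY.

Definition is_y (c : action) : bool := if c is ActY then true else false.
Definition action_of_bool (b : bool) : action := if b then ActY else ActX.
Lemma is_yK : cancel is_y action_of_bool. Proof. by case. Qed.
HB.instance Definition _ := Finite.copy action (can_type is_yK).

Section CoordinationGame.

(* Agents are the elements of [T]; [E] is the adjacency relation of the graph. *)
Variables (R : realType) (T : finType) (E : rel T) (alpha : R).

Definition joint_action := {ffun T -> action}.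

Definition all_y : joint_action := [ffun => ActY].

Definition payoff (c d : action) : R :=
  match c, d with
  | ActX, ActX => 1 + alpha
  | ActY, ActY => 1
  | _, _ => 0
  end.

Definition utility (i : T) (a : joint_action) : R :=
  \sum_(j | E i j) payoff (a i) (a j).

Variable S : {set T}.

Definition influenced_utility (i : T) (a : joint_action) : R :=
  if (i \in S) && (a i == ActY) then utility i a + 1 else utility i a.

(* The joint action (c, a_{-i}). *)
Definition deviate (a : joint_action) (i : T) (c : action) : joint_action :=
  [ffun j => if j == i then c else a j].

Variable beta : R.

Definition prob_x (i : T) (a : joint_action) : R :=
  let wx := expR (beta * influenced_utility i (deviate a i ActX)) in
  let wy := expR (beta * influenced_utility i (deviate a i ActY)) in
  wx / (wx + wy).

Definition choice_prob (i : T) (a : joint_action) (c : action) : R :=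
  if c is ActX then prob_x i a else 1 - prob_x i a.

Definition transition (a a' : joint_action) : R :=
  \sum_(i : T) #|T|%:R^-1 *
    \sum_(c : action | deviate a i c == a') choice_prob i a c.

Definition stationary (p : {ffun joint_action -> R}) : Prop :=
  [/\ forall a, 0 <= p a,
      \sum_a p a = 1
    & forall a', \sum_a p a * transition a a' = p a'].

End CoordinationGame.

(* [pi] is the pointwise limit, as beta -> +oo, of the unique stationary
   distributions pi_beta (existence and uniqueness are part of the predicate). *)
Definition limit_distribution (R : realType) (T : finType) (E : rel T)
    (alpha : R) (S : {set T}) (pi : {ffun joint_action T -> R}) : Prop :=
  exists2 pi_ : R -> {ffun joint_action T -> R},
    forall beta : R, 0 < beta -> unique (stationary E alpha S beta) (pi_ beta)
  & forall a : joint_action T, pi_ beta a @[beta --> +oo] --> pi a.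

Definition strictly_stochastically_stable (R : realType) (T : finType)
    (E : rel T) (alpha : R) (S : {set T}) (a : joint_action T) : Prop :=
  exists2 pi : {ffun joint_action T -> R},
    limit_distribution E alpha S pi & pi a = 1.

Definition susceptible (R : realType) (T : finType) (E : rel T) (alpha : R)
    (k : nat) : Prop :=
  exists2 S : {set T}, #|S| = k
    & strictly_stochastically_stable E alpha S (all_y T).

(* The supremum is taken in the extended reals, so that no default value is
   involved when the set is empty or unbounded. *)
Definition alpha_sus (R : realType) (T : finType) (E : rel T) (k : nat) :
    \bar R :=
  ereal_sup [set alpha%:E | alpha in [set alpha : R | susceptible E alpha k]].

(* Nodes are numbered 0, ..., n-1, and [ordS i] is i + 1 modulo n. *)
Definition ring_graph (n : nat) : rel 'I_n :=
  fun i j => (j == ordS i) || (i == ordS j).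
Arguments ring_graph : clear implicits.

(* The interval [i, i + t - 1], with indices modulo n. *)
Definition ring_arc (n : nat) (i : 'I_n) (t : nat) : {set 'I_n} :=
  [set iter s (@ordS n) i | s : 'I_t]%SET.

Definition evenly_spread (n k : nat) (S : {set 'I_n}) : Prop :=
  forall (i : 'I_n) (t : nat), (1 <= t <= n)%N ->
    #|S :&: ring_arc i t|%:Z <= Num.ceil ((k * t)%:R / n%:R : rat).

(* Main.v *)
Require Import Defs.
From mathcomp Require Import all_boot all_order all_algebra.
From mathcomp Require Import all_classical all_reals all_analysis.
From mathcomp Require Import ring lra zify.

(* The game has an exact potential, the welfare of the edges plus the number of
   influenced y-players, so log-linear learning is reversible with respect to
   the Gibbs measure of the potential, and an action is strictly stochastically
   stable iff it is the unique maximizer of the potential.  On the ring,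
   comparing all-y (n + k) with all-x (n (1 + alpha)) gives alpha < k/n.
   Conversely an evenly spread S makes |S cap [0, i)| - i k/n oscillate by less
   than 1 around the ring, and a summation by parts then shows that all-y beats
   every mixed action as soon as alpha < k/n. *)

Set Implicit Arguments.
Unset Strict Implicit.
Unset Printing Implicit Defensive.

Import Order.TTheory GRing.Theory Num.Theory.
Import numFieldNormedType.Exports.

Local Open Scope ring_scope.

Lemma big_action (R : nmodType) (F : action -> R) :
  \sum_(c : action) F c = F ActX + F ActY.
Proof.
rewrite (bigD1 ActX) //= (bigD1 ActY) //= big1 ?addr0 //.
by case=> //; rewrite ?eqxx ?andbF.
Qed.

(** * Reversibility of log-linear learning and its Gibbs measure *)

Section Gibbs.

Variables (R : realType) (T : finType) (E : rel T) (alpha : R) (S : {set T}).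

(** The factor [2^-1] compensates for each edge being counted from both of its ends. *)
Definition potential (a : joint_action T) : R :=
  2^-1 * \sum_i utility E alpha i a + \sum_(i in S) (is_y (a i))%:R.

Lemma payoffC (c d : action) : payoff alpha c d = payoff alpha d c.
Proof. by case: c d => [] []. Qed.

Lemma deviate_id (a : joint_action T) i : deviate a i (a i) = a.
Proof. by apply/ffunP=> j; rewrite ffunE; case: eqP => [->|]. Qed.

Lemma deviate_deviate (a : joint_action T) i c d :
  deviate (deviate a i c) i d = deviate a i d.
Proof. by apply/ffunP=> j; rewrite !ffunE; case: eqP. Qed.

Hypotheses (E_sym : symmetric E) (E_irr : irreflexive E).

(** Edges at [i] occur once in the utility of [i] and once among its neighbours, so halving leaves
    one copy. The remainder does not involve the action of [i], which makes the potential exact. *)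
Lemma potential_split (a : joint_action T) i :
  potential a = influenced_utility E alpha S i a +
    (2^-1 * \sum_(j | j != i) \sum_(l | E j l && (l != i))
        payoff alpha (a j) (a l)
     + \sum_(j in S | j != i) (is_y (a j))%:R).
Proof.
have pairs : \sum_j utility E alpha j a = 2 * utility E alpha i a
    + \sum_(j | j != i) \sum_(l | E j l && (l != i)) payoff alpha (a j) (a l).
  rewrite (bigD1 i) //= mulr2n mulrDl mul1r -addrA; congr (_ + _).
  have -> : utility E alpha i a =
      \sum_(j | j != i) \sum_(l | E j l && (l == i)) payoff alpha (a j) (a l).
    under eq_bigr => j _ do rewrite big_mkcondl big_pred1_eq E_sym payoffC.
    rewrite -big_mkcondr; apply: eq_bigl => j.
    by case: eqP => [->|]; rewrite ?E_irr.
  rewrite -big_split; apply: eq_bigr => j _.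
  by rewrite /utility (bigID (fun l => l == i)).
have bonus : \sum_(j in S) (is_y (a j))%:R =
    ((i \in S) && (a i == ActY))%:R + \sum_(j in S | j != i) (is_y (a j))%:R
    :> R.
  rewrite (bigID (fun j => j == i)) /= big_mkcondl big_pred1_eq.
  by case: (i \in S); case: (a i).
rewrite /potential pairs bonus /influenced_utility.
by case: (_ && _) => /=; lra.
Qed.

Lemma potential_deviate (a : joint_action T) i :
  exists r, forall c, potential (deviate a i c) =
    influenced_utility E alpha S i (deviate a i c) + r.
Proof.
eexists => c; rewrite (potential_split _ i); congr (_ + (_ * _ + _)).
- apply: eq_bigr => j ji; apply: eq_bigr => l /andP[_ li].
  by rewrite !ffunE (negPf ji) (negPf li).
- by apply: eq_bigr => j /andP[_ ji]; rewrite ffunE (negPf ji).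
Qed.

Variable beta : R.

Definition gibbs_weight (a : joint_action T) : R := expR (beta * potential a).

Definition gibbs : {ffun joint_action T -> R} :=
  [ffun a => gibbs_weight a / \sum_b gibbs_weight b].

Lemma gibbs_weight_gt0 a : 0 < gibbs_weight a.
Proof. exact: expR_gt0. Qed.

Lemma partition_gt0 : 0 < \sum_a gibbs_weight a.
Proof.
apply: (lt_le_trans (gibbs_weight_gt0 (all_y T))).
rewrite (bigD1 (all_y T)) //= lerDl.
by apply: sumr_ge0 => b _; exact: ltW (gibbs_weight_gt0 b).
Qed.

Lemma gibbs_gt0 a : 0 < gibbs a.
Proof. by rewrite ffunE divr_gt0 ?gibbs_weight_gt0 ?partition_gt0. Qed.

Lemma gibbs_sum : \sum_a gibbs a = 1.
Proof.
under eq_bigr do rewrite ffunE.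
by rewrite -mulr_suml divff // gt_eqF // partition_gt0.
Qed.

Local Notation choice := (choice_prob E alpha S beta).
Local Notation P := (transition E alpha S beta).

(** An update of [i] resamples its action from the Gibbs measure conditioned on all other actions:
    the part of the potential independent of [c] and the partition function cancel. *)
Lemma choice_probE i a c : choice i a c =
  gibbs (deviate a i c) / (gibbs (deviate a i ActX) + gibbs (deviate a i ActY)).
Proof.
have [r rE] := potential_deviate a i.
pose w c := expR (beta * influenced_utility E alpha S i (deviate a i c)).
pose K := expR (beta * r) / \sum_b gibbs_weight b.
have gE d : gibbs (deviate a i d) = w d * K.
  by rewrite ffunE /gibbs_weight rE mulrDr expRD -mulrA.
have K0 : K != 0 by rewrite gt_eqF // divr_gt0 ?expR_gt0 ?partition_gt0.
have w0 : w ActX + w ActY != 0 by rewrite gt_eqF // addr_gt0 ?expR_gt0.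
rewrite !gE -mulrDl; case: c; rewrite /= /prob_x -!/(w _).
  by field; rewrite K0 w0.
by field; rewrite K0 w0.
Qed.

Lemma choice_prob_gt0 i a c : 0 < choice i a c.
Proof. by rewrite choice_probE divr_gt0 ?addr_gt0 ?gibbs_gt0. Qed.

(** Balance holds agent by agent: a move by [i] between [a] and [b] forces them to agree off [i],
    and then both directions use the same conditional law. *)
Lemma detailed_balance a b : gibbs a * P a b = gibbs b * P b a.
Proof.
rewrite /transition !mulr_sumr; apply: eq_bigr => i _.
rewrite mulrCA [RHS]mulrCA; congr (_ * _).
have dev (x y : joint_action T) : \sum_(c | deviate x i c == y) choice i x c =
    if deviate x i (y i) == y then choice i x (y i) else 0.
  rewrite big_mkcond (bigD1 (y i)) //= big1 ?addr0 // => c /eqP cy.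
  case: eqP => // xy; case: cy.
  by rewrite -xy ffunE eqxx.
have sym (x y : joint_action T) :
    deviate x i (y i) = y -> deviate y i (x i) = x.
  by move=> <-; rewrite deviate_deviate deviate_id.
rewrite !dev; case: eqP => [ab|nab]; last first.
  by case: eqP => [/sym//|_]; rewrite !mulr0.
rewrite (sym _ _ ab) eqxx !choice_probE ab (sym _ _ ab).
have devE c : deviate b i c = deviate a i c by rewrite -ab deviate_deviate.
by rewrite !devE mulrCA.
Qed.

Lemma transition_sum (f : joint_action T -> R) a :
  \sum_b P a b * f b =
  \sum_i #|T|%:R^-1 * \sum_c choice i a c * f (deviate a i c).
Proof.
under eq_bigr do rewrite mulr_suml.
rewrite exchange_big; apply: eq_bigr => i _ /=.
under eq_bigr do rewrite -mulrA mulr_suml.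
rewrite -mulr_sumr; congr (_ * _).
rewrite (exchange_big_dep xpredT) //=; apply: eq_bigr => c _.
by under eq_bigl do rewrite eq_sym; rewrite big_pred1_eq.
Qed.

Hypothesis T_gt0 : (0 < #|T|)%N.

Lemma transition_sum1 a : \sum_b P a b = 1.
Proof.
under eq_bigr do rewrite -[P _ _]mulr1.
rewrite transition_sum -mulr_sumr.
under eq_bigr do rewrite big_action /= !mulr1 subrKC.
by rewrite sumr_const -(mulr_natr 1) mul1r mulVf // pnatr_eq0 -lt0n.
Qed.

Lemma gibbs_stationary : stationary E alpha S beta gibbs.
Proof.
split=> [a|| b]; [exact: ltW (gibbs_gt0 a) | exact: gibbs_sum |].
under eq_bigr do rewrite detailed_balance.
by rewrite -mulr_sumr transition_sum1 mulr1.
Qed.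

Lemma transition_deviate_gt0 a i c : 0 < P a (deviate a i c).
Proof.
rewrite /transition (bigD1 i) //= (bigD1 c) //=.
have inv0 : 0 < #|T|%:R^-1 :> R by rewrite invr_gt0 ltr0n.
apply: ltr_pwDl.
  rewrite mulr_gt0 // ltr_pwDl ?choice_prob_gt0 //.
  by apply: sumr_ge0 => d _; exact: ltW (choice_prob_gt0 _ _ _).
apply: sumr_ge0 => j _; rewrite mulr_ge0 ?(ltW inv0) //.
by apply: sumr_ge0 => d _; exact: ltW (choice_prob_gt0 _ _ _).
Qed.

Lemma transition_ge0 a b : 0 <= P a b.
Proof.
apply: sumr_ge0 => j _; rewrite mulr_ge0 ?invr_ge0 ?ler0n //.
by apply: sumr_ge0 => d _; exact: ltW (choice_prob_gt0 _ _ _).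
Qed.

(** Irreducibility in the form of an induction principle: the agents switch from [a] to [b] one at a
    time. *)
Lemma deviate_connected (Q : joint_action T -> Prop) a b :
  (forall a i c, Q a -> Q (deviate a i c)) -> Q a -> Q b.
Proof.
move=> Qdev Qa.
pose m (s : seq T) : joint_action T := [ffun j => if j \in s then b j else a j].
have Qm s : Q (m s).
  elim: s => [|i s IH].
    by rewrite (_ : m _ = a) //; apply/ffunP => j; rewrite ffunE.
  rewrite (_ : m _ = deviate (m s) i (b i)); first exact: Qdev.
  by apply/ffunP => j; rewrite !ffunE inE; case: eqP => [->|].
rewrite (_ : b = m (enum T)) //.
by apply/ffunP => j; rewrite ffunE mem_enum.
Qed.

(* By reversibility the density of a stationary distribution with respect to
   the Gibbs measure is harmonic, hence constant by the maximum principle. *)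
Lemma stationary_unique q : stationary E alpha S beta q -> gibbs = q.
Proof.
move=> [_ q1 qP].
pose h a := q a / gibbs a.
have g0 a : gibbs a != 0 by rewrite gt_eqF // gibbs_gt0.
have qE a : q a = h a * gibbs a by rewrite /h divfK.
have harm a : \sum_b P a b * h b = h a.
  rewrite [RHS]/h -qP mulr_suml; apply: eq_bigr => b _.
  by rewrite qE -(mulrA (h b)) detailed_balance; field; exact: g0.
pose m := [arg max_(a > all_y T) h a]%O.
have hm a : h a <= h m by rewrite /m; case: arg_maxP => // ? _; exact.
have hconst b : h b = h m.
  apply: (deviate_connected (Q := fun b => h b = h m) (a := m)) => // a i c ha.
  have : \sum_b P a b * (h a - h b) = 0.
    under eq_bigr do rewrite mulrBr.
    by rewrite sumrB harm -mulr_suml transition_sum1 mul1r subrr.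
  move=> /eqP; rewrite psumr_eq0; last first.
    by move=> d _; rewrite mulr_ge0 ?transition_ge0 // subr_ge0 ha.
  move=> /allP /(_ (deviate a i c) (mem_index_enum _)) /=.
  rewrite mulf_eq0 gt_eqF ?transition_deviate_gt0 //= subr_eq0 ha.
  by move/eqP.
have hm1 : h m = 1.
  rewrite -q1; under [RHS]eq_bigr do rewrite qE hconst.
  by rewrite -mulr_sumr gibbs_sum mulr1.
by apply/ffunP => a; rewrite qE hconst hm1 mul1r.
Qed.

End Gibbs.

(** * The limit of large [beta] and strict maximizers of the potential *)

Section Stability.

Local Open Scope classical_set_scope.

Variables (R : realType) (T : finType) (E : rel T) (alpha : R) (S : {set T}).
Hypotheses (E_sym : symmetric E) (E_irr : irreflexive E).
Hypothesis T_gt0 : (0 < #|T|)%N.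

Local Notation Phi := (potential E alpha S).
Local Notation G := (gibbs E alpha S).

Lemma gibbs_cvg (m : joint_action T) :
  (forall a, a != m -> Phi a < Phi m) ->
  forall a, G beta a @[beta --> +oo] --> ((a == m)%:R : R).
Proof.
move=> max_m a.
(* Weights relative to the maximizer [m]: [r m] is constantly 1, and all others decay to 0. *)
pose r b (beta : R) := expR (- (beta * (Phi m - Phi b))).
have rE : (fun beta => G beta a) = fun beta => r a beta / \sum_b r b beta.
  apply/funext => beta; rewrite ffunE /gibbs_weight.
  have wE b : expR (beta * Phi b) = expR (beta * Phi m) * r b beta.
    by rewrite -expRD; congr expR; ring.
  under eq_bigr do rewrite wE.
  by rewrite wE -mulr_sumr -mulf_div divff ?mul1r // gt_eqF ?expR_gt0.
have r_cvg b : r b beta @[beta --> +oo] --> ((b == m)%:R : R).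
  rewrite /r; case: eqP => [->|/eqP /max_m ltbm].
    by under eq_fun do rewrite subrr mulr0 oppr0 expR0; exact: cvg_cst.
  apply: (@cvg_comp _ _ _ (fun beta => beta * (Phi m - Phi b))
    (fun x => expR (- x)) _ +oo%R); last exact: cvgr_expR.
  by apply: gt0_cvgMly; [rewrite subr_gt0 | exact: cvg_id].
have sum_cvg : \sum_b r b beta @[beta --> +oo] --> (1 : R).
  have -> : (1 : R) = \sum_(b : joint_action T) (b == m)%:R.
    by rewrite (bigD1 m) //= eqxx big1 ?addr0 // => b /negPf ->.
  by apply: cvg_big => //; exact: add_continuous.
rewrite rE -[X in _ --> X]divr1; apply: cvgM => //.
by apply: cvgV => //; exact: oner_neq0.
Qed.

Lemma strict_max_stable (m : joint_action T) :
  (forall a, a != m -> Phi a < Phi m) ->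
  strictly_stochastically_stable E alpha S m.
Proof.
move=> max_m.
exists [ffun a => (a == m)%:R]; last by rewrite ffunE eqxx.
exists (fun beta => G beta) => [beta _|a].
  split; first exact: gibbs_stationary.
  by move=> q; exact: stationary_unique.
by rewrite ffunE; exact: gibbs_cvg.
Qed.

Lemma stable_strict_max (m b : joint_action T) :
  strictly_stochastically_stable E alpha S m -> b != m -> Phi b < Phi m.
Proof.
move=> [p [p_ p_uniq p_cvg] pm1] bm; rewrite ltNge; apply/negP => le_mb.
(* If [b] does at least as well as [m], it has at least the mass of [m] for every positive [beta],
   so [m] never holds more than half. *)
have : p m <= 2^-1.
  apply: (cvgr_to_le (p_cvg m)).
  near=> beta.
  have beta_gt0 : 0 < beta by near: beta; exact: nbhs_pinfty_gt.
  have [st _] := p_uniq _ beta_gt0.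
  rewrite -(stationary_unique E_sym E_irr T_gt0 st).
  have le_g : G beta m <= G beta b.
    rewrite !ffunE ler_pM2r ?invr_gt0 ?partition_gt0 //.
    by rewrite ler_expR ler_pM2l.
  have : G beta m + G beta b <= 1.
    rewrite -(gibbs_sum E alpha S beta) (bigD1 m) //= lerD2l.
    rewrite (bigD1 b) //= lerDl.
    by apply: sumr_ge0 => c _; rewrite ltW // gibbs_gt0.
  lra.
rewrite pm1; lra.
Unshelve. all: by end_near. Qed.

End Stability.

(** * Counting influenced nodes along arcs of the ring *)

Section Ring.

Variable n' : nat.
Local Notation n := n'.+1.
Implicit Types (S : {set 'I_n}) (i j : 'I_n).

Lemma val_iter_ordS s i : iter s (@ordS n) i = ((i + s) %% n)%N :> nat.
Proof.
elim: s => [|s IH]; first by rewrite addn0 modn_small.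
by rewrite iterS /= IH -addn1 modnDml addn1 addnS.
Qed.

Lemma iter_ordS_ord0 i : iter i (@ordS n) ord0 = i.
Proof. by apply: val_inj; rewrite /= val_iter_ordS add0n modn_small. Qed.

(* The time m is not reduced modulo n, so that arcs through the node 0 need no
   separate treatment. *)
Definition visits S m : nat :=
  (\sum_(0 <= s < m) (iter s (@ordS n) ord0 \in S))%N.

(** At most [n] consecutive nodes are distinct, so arc counts become differences of the cumulative
    count, even when [i + t] passes [n]. *)
Lemma card_arc S i t : (t <= n)%N ->
  (visits S i + #|S :&: ring_arc i t|)%N = visits S (i + t).
Proof.
move=> le_tn.
have inj : injective (fun s : 'I_t => iter s (@ordS n) i).
  move=> s1 s2 /(congr1 val) /=; rewrite !val_iter_ordS => /eqP.
  rewrite eqn_modDl !modn_small ?(leq_trans (ltn_ord _)) //.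
  by move/eqP; exact: val_inj.
have -> : #|S :&: ring_arc i t| = (\sum_(s < t) (iter s (@ordS n) i \in S))%N.
  rewrite -sum1_card; under eq_bigl do rewrite inE andbC.
  rewrite big_mkcondr big_imset /=; last by move=> s1 s2 _ _; exact: inj.
  by apply: eq_bigr => s _; case: (_ \in _).
rewrite /visits [RHS](@big_cat_nat _ _ _ i) //= ?leq_addr //; congr addn.
rewrite -[in RHS](add0n (i : nat)) big_addn add0n addKn big_mkord.
by apply: eq_bigr => s _; rewrite iterD iter_ordS_ord0.
Qed.

Lemma ring_arc_full i : ring_arc i n = [set: 'I_n].
Proof.
apply/setP => j; rewrite inE; apply/imsetP.
(* The number of steps from [i] to [j]; adding [n] first keeps the subtraction from truncating. *)
have lt : ((j + n - i) %% n < n)%N by rewrite ltn_mod.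
exists (Ordinal lt) => //; apply: val_inj; rewrite /= val_iter_ordS /= modnDmr.
by rewrite subnKC ?modnDr ?modn_small // ltnW // ltn_addl.
Qed.

Lemma visits_period S i : visits S (i + n) = (visits S i + #|S|)%N.
Proof. by rewrite -card_arc // ring_arc_full finset.setIT. Qed.

Lemma visitsS S i : visits S i.+1 = (visits S i + (i \in S))%N.
Proof. by rewrite /visits big_nat_recr //= iter_ordS_ord0. Qed.

Lemma visits0 S : visits S 0 = 0%N.
Proof. by rewrite /visits big_geq. Qed.

Lemma le_ceil_nat (m p d : nat) : (0 < d)%N ->
  (m%:Z <= Num.ceil (p%:R / d%:R : rat)) = (m * d < p + d)%N.
Proof.
move=> d0; rewrite -[m%:Z](subrK 1) lezD1 ceil_gt_int rmorphB /=.
by rewrite ltr_pdivlMr ?ltr0n // mulrBl ltrBlDr mul1r -natrM -natrD ltr_nat.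
Qed.

(** Node [j] is taken when the floor of [j * k / n] jumps at [j.+1]. As [k <= n], jumps are at most
    1, so the cumulative count is this floor, and an arc of length [t] counts less than
    [k * t / n + 1]. *)
Lemma exists_evenly_spread k : (k <= n)%N ->
  exists2 S : {set 'I_n}, #|S| = k & evenly_spread k S.
Proof.
move=> le_kn.
pose S := [set j : 'I_n | j * k %/ n < j.+1 * k %/ n]%N.
have visitsE m : visits S m = (m * k %/ n)%N.
  elim: m => [|m IH]; first by rewrite visits0.
  rewrite /visits big_nat_recr //= -/(visits S m) IH inE val_iter_ordS add0n.
  (* Membership is tested at the residue of [m]; full turns add the same multiple of [k] to both
     floors. *)
  have -> : m.+1 = (m %/ n * n + (m %% n).+1)%N by rewrite addnS -divn_eq.
  rewrite {1}(divn_eq m n).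
  have distr x : ((m %/ n * n + x) * k = (m %/ n * k) * n + x * k)%N.
    by rewrite mulnDl mulnAC.
  rewrite !distr !divnMDl // mulSn; set x := (_ %% n * k)%N.
  have : (x %/ n <= (k + x) %/ n)%N by rewrite leq_div2r // leq_addl.
  have : ((k + x) %/ n <= (x %/ n).+1)%N.
    by rewrite -[(x %/ n).+1]add1n -divnMDl // mul1n leq_div2r // leq_add2r.
  lia.
exists S.
  by have := visits_period S ord0; rewrite !visitsE add0n mul0n div0n mulKn.
move=> i t /andP[_ le_tn]; rewrite le_ceil_nat //.
have := card_arc S i le_tn; rewrite !visitsE => /(congr1 (muln^~ n)) /=.
rewrite mulnDl.
have := divn_eq (i * k) n; have := divn_eq ((i + t) * k) n.
have := ltn_pmod (i * k) (ltn0Sn n').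
have := ltn_pmod ((i + t) * k) (ltn0Sn n').
lia.
Qed.

(** * Discrepancy of an evenly spread influence set *)

Section Height.

Variables (R : realType) (k : nat) (S : {set 'I_n}).
Hypotheses (card_S : #|S| = k) (S_even : evenly_spread k S).

Definition height i : R := (visits S i)%:R - i%:R * (k%:R / n%:R).

(** The step from the last node back to 0 obeys the same rule, because a full turn meets [k]
    influenced nodes and its total drift is also [k]. *)
Lemma height_ordS i : height (ordS i) - height i = (i \in S)%:R - k%:R / n%:R.
Proof.
have n0 : n%:R != 0 :> R by rewrite pnatr_eq0.
have := visitsS S i; rewrite /height /=.
have [lt_in|ge_in] := ltnP i.+1 n.
  rewrite modn_small // => ->; rewrite natrD -[in X in X * _]addn1 natrD; ring.
have i_last : i.+1 = n by apply/eqP; rewrite eqn_leq ge_in ltn_ord.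
have iR : i%:R = n%:R - 1 :> R by rewrite -[in RHS]i_last -natr1 addrK.
have := visits_period S ord0; rewrite i_last add0n visits0 card_S => ->.
rewrite add0n modnn visits0 iR => /(congr1 (fun m => m%:R : R)).
rewrite natrD => kE.
rewrite (_ : (visits S i)%:R = k%:R - (i \in S)%:R); last by rewrite kE addrK.
by field.
Qed.

(** The difference is the count on the arc from [i] up to [j] minus its mean, and the ceiling bound
    exceeds the mean by less than 1. *)
Lemma height_lt1 i j : height j - height i < 1.
Proof.
have n0 : 0 < n%:R :> R by rewrite ltr0n.
rewrite -(ltr_pM2r n0) /height.
have -> : ((visits S j)%:R - j%:R * (k%:R / n%:R) -
    ((visits S i)%:R - i%:R * (k%:R / n%:R))) * n%:R =
    (visits S j * n + i * k)%:R - (visits S i * n + j * k)%:R :> R.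
  by rewrite !natrD !natrM; field; rewrite gt_eqF.
rewrite mul1r ltrBlDr -natrD ltr_nat.
case: (ltngtP i j) => [lt_ij|lt_ji|/val_inj ->]; last by lia.
- have t_gt0 : (1 <= j - i <= n)%N.
    by rewrite subn_gt0 lt_ij leq_subLR ltnW // ltn_addl.
  have := S_even i t_gt0; rewrite le_ceil_nat //.
  have := card_arc S i (proj2 (andP t_gt0)); rewrite subnKC ?(ltnW lt_ij) //.
  move=> /(congr1 (muln^~ n)) /=; rewrite mulnDl mulnBr.
  have := leq_mul (leqnn k) (ltnW lt_ij).
  rewrite ![(k * _)%N]mulnC; clear.
  move: (_ * n)%N (_ * n)%N (_ * n)%N (_ * k)%N (_ * k)%N; lia.
(* Here the arc wraps through node 0; the extra turn adds [k] to both the count and the mean. *)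
- have lt_in := ltn_ord i.
  have t_bd : (1 <= n + j - i <= n)%N by lia.
  have := S_even i t_bd; rewrite le_ceil_nat //.
  have := card_arc S i (proj2 (andP t_bd)).
  have -> : (i + (n + j - i) = j + n)%N by lia.
  rewrite visits_period card_S => /(congr1 (muln^~ n)) /=; rewrite !mulnDl.
  have : (k * (n + j - i) + k * i = k * n + k * j)%N.
    by rewrite -!mulnDr subnK // (leq_trans (ltnW lt_in)) ?leq_addr.
  rewrite ![(k * _)%N]mulnC; clear.
  move: (_ * n)%N (_ * n)%N (_ * n)%N (_ * k)%N (_ * k)%N (_ * k)%N (_ * k)%N.
  lia.
Qed.

End Height.

End Ring.

(** * The potential on the ring and its maximizer *)

Section RingPotential.

Variables (R : realType) (n' k : nat).
Local Notation n := n'.+1.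
Hypothesis n_ge3 : (3 <= n)%N.

Lemma ring_graph_sym : symmetric (ring_graph n).
Proof. by move=> i j; rewrite /ring_graph orbC. Qed.

Lemma ordS_neq (i : 'I_n) : ordS i != i.
Proof.
rewrite -val_eqE /=; have [lt_in|ge_in] := ltnP i.+1 n.
  by rewrite modn_small // gtn_eqF.
have -> : i.+1 = n by apply/eqP; rewrite eqn_leq ge_in ltn_ord.
by rewrite modnn; lia.
Qed.

(** With [n >= 3] the two neighbours of a node are distinct, so no edge is doubled. *)
Lemma ordS_ordS_neq (i : 'I_n) : ordS (ordS i) != i.
Proof.
rewrite -val_eqE (_ : val _ = ((i + 2) %% n)%N); last exact: (val_iter_ordS 2).
have [lt_in|ge_in] := ltnP (i + 2) n; first by rewrite modn_small //=; lia.
have lt_in := ltn_ord i.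
by rewrite -(subnK ge_in) modnDr modn_small /=; lia.
Qed.

Lemma ring_graph_irr : irreflexive (ring_graph n).
Proof.
by move=> i; rewrite /ring_graph orbb eq_sym (negPf (ordS_neq i)).
Qed.

(** Each edge is charged to its first node: reindexing turns the predecessor sum into the successor
    sum, which absorbs the factor one half. *)
Lemma ring_potentialE alpha (S : {set 'I_n}) (a : joint_action 'I_n) :
  potential (ring_graph n) alpha S a =
  \sum_i payoff alpha (a i) (a (ordS i)) + \sum_(i in S) (is_y (a i))%:R :> R.
Proof.
congr (_ + _).
have -> : \sum_i utility (ring_graph n) alpha i a =
    \sum_i payoff alpha (a i) (a (ordS i))
    + \sum_i payoff alpha (a i) (a (ord_pred i)).
  rewrite -big_split; apply: eq_bigr => i _.
  rewrite /utility (bigD1 (ordS i)) /=; last by rewrite /ring_graph eqxx.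
  congr (_ + _); apply: big_pred1 => j; rewrite /ring_graph /=.
  rewrite -[j == ord_pred i](can_eq (@ordSK n)) ord_predK [i == _]eq_sym.
  have [<-|_] := eqVneq (ordS j) i; last by case: eqP.
  by rewrite orbT eq_sym ordS_ordS_neq.
rewrite (reindex_inj (can_inj (@ordSK n))
  (F := fun i => payoff _ _ (a (ord_pred i)))) /=.
under [X in _ * (_ + X)]eq_bigr do rewrite ordSK payoffC.
by lra.
Qed.

Lemma potential_all_y alpha (S : {set 'I_n}) :
  potential (ring_graph n) alpha S (all_y 'I_n) = n%:R + #|S|%:R :> R.
Proof.
rewrite ring_potentialE -sum1_card natr_sum; congr (_ + _).
  under eq_bigr do rewrite !ffunE.
  by rewrite sumr_const card_ord.
by apply: eq_bigr => i _; rewrite ffunE.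
Qed.

Definition all_x : joint_action 'I_n := [ffun=> ActX].

Lemma potential_all_x alpha (S : {set 'I_n}) :
  potential (ring_graph n) alpha S all_x = n%:R * (1 + alpha) :> R.
Proof.
rewrite ring_potentialE [X in _ + X]big1 ?addr0; last first.
  by move=> i _; rewrite ffunE.
under eq_bigr do rewrite !ffunE.
by rewrite sumr_const card_ord mulr_natl.
Qed.

Lemma constant_action (a : joint_action 'I_n) :
  (forall i, a (ordS i) = a i) -> a = [ffun=> a ord0].
Proof.
move=> a_const; apply/ffunP => i; rewrite ffunE -(iter_ordS_ord0 i).
by elim: (i : nat) => //= m IH; rewrite a_const.
Qed.

(* Replacing alpha by k/n, the potential lost by the x-players is the number of
   mixed edges plus the sum of the increments of [height] over the x-players;
   summation by parts turns that sum into one over the mixed edges, where each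
   term exceeds -1 since [height] oscillates by less than 1. *)
Lemma even_potential_lt alpha (S : {set 'I_n}) (a : joint_action 'I_n) :
  #|S| = k -> evenly_spread k S -> alpha < k%:R / n%:R -> a != all_y 'I_n ->
  potential (ring_graph n) alpha S a
  < potential (ring_graph n) alpha S (all_y 'I_n) :> R.
Proof.
move=> card_S S_even lt_alpha not_y.
have n_gt0 : 0 < n%:R :> R by rewrite ltr0n.
have [/forallP const|] := boolP [forall i, a (ordS i) == a i].
  have aE : a = [ffun=> a ord0] by apply: constant_action => i; exact/eqP.
  have -> : a = all_x.
    case a0: (a ord0) aE => aE //; rewrite -/all_x in aE.
    by rewrite aE eqxx in not_y.
  rewrite potential_all_x potential_all_y card_S mulrDr mulr1 ltrD2l.
  by rewrite mulrC -ltr_pdivlMr.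
rewrite negb_forall => /existsP[i0 mixed_i0].
pose x i : R := (~~ is_y (a i))%:R.
pose h := height R k S.
(* The loss of an edge against all-y: 1 if mixed, [- alpha] if both ends play x, 0 otherwise. *)
pose g i := 1 - payoff alpha (a i) (a (ordS i)).
rewrite potential_all_y card_S ring_potentialE -subr_gt0.
have -> : n%:R + k%:R - (\sum_i payoff alpha (a i) (a (ordS i)) +
    \sum_(i in S) (is_y (a i))%:R) = \sum_i (g i + (i \in S)%:R * x i).
  rewrite big_split sumrB sumr_const card_ord /=.
  have -> : \sum_i (i \in S)%:R * x i = k%:R - \sum_(i in S) (is_y (a i))%:R.
    rewrite -card_S -sum1_card natr_sum -sumrB [RHS]big_mkcond.
    apply: eq_bigr => i _; rewrite /x.
    by case: (i \in S); case: (is_y (a i));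
      rewrite /= ?mul1r ?mul0r ?subrr ?subr0.
  ring.
(* Subtracting [h i0] leaves the sum unchanged, since the increments of [x] cancel around the ring,
   and brings the coefficient strictly between -1 and 1. *)
pose f i := `|x i - x (ordS i)| + (h (ordS i) - h i0) * (x i - x (ordS i)).
have f_le : \sum_i f i <= \sum_i (g i + (i \in S)%:R * x i).
  have -> : \sum_i f i =
      \sum_i (`|x i - x (ordS i)| + (h (ordS i) - h i) * x i).
    rewrite !big_split /=; congr (_ + _).
    have shift (F : 'I_n -> R) : \sum_i F i = \sum_i F (ordS i).
      by rewrite (reindex_inj (can_inj (@ordSK n))).
    apply/eqP; rewrite -subr_eq0 -sumrB.
    rewrite (eq_bigr (fun i => (h i - h i0) * x i -
        (h (ordS i) - h i0) * x (ordS i))); last by move=> i _; ring.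
    by rewrite sumrB (shift (fun i => (h i - h i0) * x i)) subrr.
  (* Only edges with both ends playing x need [alpha < k/n]; the other cases use at most
     [0 <= k/n]. *)
  apply: ler_sum => i _; rewrite /h height_ordS // /g /x.
  have : 0 <= k%:R / n%:R :> R by rewrite divr_ge0.
  move: (k%:R / n%:R) lt_alpha => q lt_alpha q_ge0.
  by case: (i \in S); case: (a i); case: (a (ordS i));
    rewrite /= ?(mulr0n, mulr1n, subrr, subr0, sub0r, normrN, normr0,
      normr1); lra.
apply: lt_le_trans f_le.
have f_ge0 i : 0 <= f i.
  rewrite /f.
  have := height_lt1 R card_S S_even i0 (ordS i).
  have := height_lt1 R card_S S_even (ordS i) i0.
  rewrite -/h /x; case: (a i); case: (a (ordS i));
    rewrite /= ?(mulr0n, mulr1n, subrr, subr0, sub0r, normrN, normr0,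
      normr1); lra.
(* The mixed edge at [i0] makes the sum strictly positive. *)
rewrite (bigD1 i0) //=; apply: ltr_pwDl; last by apply: sumr_ge0 => i _.
rewrite /f; have := height_lt1 R card_S S_even i0 (ordS i0).
have := height_lt1 R card_S S_even (ordS i0) i0.
rewrite -/h /x; move: mixed_i0; case: (a i0); case: (a (ordS i0)) => //= _;
  rewrite ?(mulr0n, mulr1n, subr0, sub0r, normrN, normr1); lra.
Qed.

End RingPotential.

Theorem theorem3 (R : realType) (n k : nat)
    (n_ge3 : (3 <= n)%N) (k_ge1 : (1 <= k)%N) (k_le_n : (k <= n)%N) :
  [/\ alpha_sus R (ring_graph n) k = (k%:R / n%:R)%:E,
      exists2 S : {set 'I_n}, #|S| = k & evenly_spread k S
    & forall (S : {set 'I_n}) (alpha : R),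
        #|S| = k -> evenly_spread k S -> alpha < k%:R / n%:R ->
        strictly_stochastically_stable (ring_graph n) alpha S (all_y 'I_n)].
Proof.
case: n n_ge3 k_le_n => // n' n_ge3 k_le_n.
have sym := @ring_graph_sym n'; have irr := ring_graph_irr n_ge3.
have T_gt0 : (0 < #|'I_n'.+1|)%N by rewrite card_ord.
have stable (S : {set 'I_n'.+1}) (alpha : R) : #|S| = k -> evenly_spread k S ->
    alpha < k%:R / n'.+1%:R ->
    strictly_stochastically_stable (ring_graph n'.+1) alpha S (all_y 'I_n'.+1).
  move=> card_S S_even lt_alpha; apply: strict_max_stable => // a.
  exact: (even_potential_lt n_ge3 card_S).
have [S card_S S_even] := exists_evenly_spread k_le_n.
split=> //; last by exists S.
apply/eqP; rewrite eq_le; apply/andP; split.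
  (* Upper bound: all-y must strictly beat all-x, whatever the influence set. *)
  apply: ge_ereal_sup => _ [alpha [S' card_S' st] <-].
  have := stable_strict_max sym irr T_gt0 st (b := all_x n') _.
  rewrite potential_all_x // potential_all_y // card_S' lee_fin.
  rewrite mulrDr mulr1 ltrD2l mulrC -ltr_pdivlMr ?ltr0n //.
  move=> lt_alpha; apply/ltW/lt_alpha.
  by apply/eqP => /ffunP /(_ ord0); rewrite !ffunE.
(* Lower bound: [k/n] is only approached from below, since at [k/n] itself all-x ties with all-y. *)
apply/lee_subgt0Pr => e e_gt0; rewrite -EFinB.
apply: ereal_sup_ubound; exists (k%:R / n'.+1%:R - e) => //.
exists S => //; apply: stable => //.
by rewrite ltrBlDr ltrDl.
Qed.
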